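(* Let $n\ge 1$ and let the quadrature rule with nodes $\mathbf{x}_1,\dots,\mathbf{x}_N\in\mathbb{S}^d$ and positive weights $w_1,\dots,w_N$ have exactness $2n$. Let $\mathcal{L}_n$ be the hyperinterpolation operator and let $\mathfrak{G}\mathfrak{L}_n$ be the generalized hyperinterpolation operator associated to a sequence $\{D_n\}_{n\ge1}$ satisfying the conditions given in the context. Then for all $f,g\in\mathcal{C}(\mathbb{S}^d)$, $\mathfrak{G}\mathfrak{L}_n$ is hyper self-adjoint, i.e. $$\langle \mathfrak{G}\mathfrak{L}_n f,g\rangle_N=\langle f,\mathfrak{G}\mathfrak{L}_n g\rangle_N,$$ and commutative with $\mathcal{L}_n$: $$\mathfrak{G}\mathfrak{L}_n(\mathcal{L}_n f)=\mathcal{L}_n(\mathfrak{G}\mathfrak{L}_n f)=\mathfrak{G}\mathfrak{L}_n f.$$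
   Context: Let $d\ge2$ and let $\mathbb{S}^d\subset\mathbb{R}^{d+1}$ be the unit sphere with Lebesgue surface measure $\mathrm{d}\omega_d(\mathbf{x})$ and total surface area $\omega_d$. $\mathcal{C}(\mathbb{S}^d)$ is the space of real continuous functions on $\mathbb{S}^d$; $\mathbb{P}_n(\mathbb{S}^d)$ is the space of restrictions to $\mathbb{S}^d$ of real polynomials of total degree at most $n$. For each $\ell\ge 0$, $\mathbb{H}_\ell(\mathbb{S}^d)$ is the space of real spherical harmonics of degree $\ell$ (restrictions of real harmonic homogeneous polynomials of degree $\ell$), $Z(d,\ell)=\dim\mathbb{H}_\ell(\mathbb{S}^d)$, and $\{Y^{(d)}_{\ell k}:k=1,\dots,Z(d,\ell)\}$ is a fixed real $L_2(\mathbb{S}^d)$-orthonormal basis of $\mathbb{H}_\ell(\mathbb{S}^d)$. The quadrature rule $\sum_{j=1}^N w_jf(\mathbf{x}_j)$ has exactness $m$ if $\sum_{j=1}^N w_jp(\mathbf{x}_j)=\int_{\mathbb{S}^d}p\,\mathrm{d}\omega_d$ for all $p\in\mathbb{P}_m(\mathbb{S}^d)$. The discrete (semi) inner product is $\langle f,g\rangle_N=\sum_{j=1}^N w_jf(\mathbf{x}_j)g(\mathbf{x}_j)$ for $f,g\in\mathcal{C}(\mathbb{S}^d)$. Hyperinterpolation operator: $\mathcal{L}_nf=\sum_{\ell=0}^n\sum_{k=1}^{Z(d,\ell)}\langle f,Y^{(d)}_{\ell k}\rangle_N Y^{(d)}_{\ell k}$. Generalized hyperinterpolation operator: let $G_\ell(t)=\frac{2\ell+d-1}{(d-1)\omega_d}C_\ell^{\frac{d-1}{2}}(t)$,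 $t\in[-1,1]$, with $C_\ell^{\frac{d-1}{2}}$ the Gegenbauer polynomial of degree $\ell$ and index $\frac{d-1}{2}$, so that $G_\ell(\mathbf{x}\cdot\mathbf{y})=\sum_{k=1}^{Z(d,\ell)}Y^{(d)}_{\ell k}(\mathbf{x})Y^{(d)}_{\ell k}(\mathbf{y})$. Let $D_n(t)=\sum_{\ell=0}^n a_{n\ell}G_\ell(t)$, $n=1,2,\dots$, with real coefficients $a_{n\ell}$, satisfy $\int_{\mathbb{S}^d}D_n(\mathbf{x}\cdot\mathbf{y})\,\mathrm{d}\omega_d(\mathbf{y})=1$ for all $\mathbf{x}\in\mathbb{S}^d$ and $n\geq 1$, and $\sup_n\int_0^\pi(1+n\theta)^2|D_n(\cos\theta)|\sin^{d-1}\theta\,\mathrm{d}\theta\le K<\infty$. Then $$\mathfrak{G}\mathfrak{L}_nf(\mathbf{x})=\sum_{j=1}^Nw_jf(\mathbf{x}_j)D_n(\mathbf{x}\cdot\mathbf{x}_j)=\sum_{\ell=0}^n a_{n\ell}\sum_{k=1}^{Z(d,\ell)}\langle f,Y^{(d)}_{\ell k}\rangle_N Y^{(d)}_{\ell k}(\mathbf{x}).$$ *)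

(* Defs.v *)
From HB Require Import structures.
From mathcomp Require Import all_boot all_order all_algebra.
(* The notations of [mpoly] clash with those of MathComp-Analysis. *)
From mathcomp Require Import -(notations) mpoly.
From mathcomp Require Import all_classical all_reals all_analysis.

Set Implicit Arguments.
Unset Strict Implicit.
Unset Printing Implicit Defensive.

Import Order.TTheory GRing.Theory Num.Theory.
Import numFieldNormedType.Exports.

Local Open Scope classical_set_scope.
Local Open Scope ring_scope.

Definition dot (R : realType) (m : nat) (x y : 'rV[R]_m) : R :=
  \sum_(i < m) x 0 i * y 0 i.

(* S^d in R^(d+1). Functions on the sphere are represented by functions on the
   ambient space; all notions below depend only on their values on the sphere. *)
Definition sphere (R : realType) (d : nat) : set 'rV[R]_d.+1 :=
  [set x | dot x x = 1].
Arguments sphere : clear implicits.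

(* Integral against the surface measure of S^d, in spherical coordinates:
   a point of S^(d+1) is (cos t, sin t *: y) with t in [0, pi] and y in S^d,
   and d omega_(d+1) = sin^d t dt d omega_d(y). The recursion starts
   from the counting measure on S^0 = {1, -1}. *)
Fixpoint sphere_int (R : realType) (d : nat) : ('rV[R]_d.+1 -> R) -> R :=
  match d return ('rV[R]_d.+1 -> R) -> R with
  | 0 => fun f => f (const_mx 1) + f (const_mx (- 1))
  | d'.+1 => fun f =>
      \int[@lebesgue_measure R]_(t in `[0, pi])
        (sin t ^+ d' *
         sphere_int (fun y : 'rV[R]_d'.+1 =>
           f (row_mx ((cos t)%:M : 'rV[R]_1) (sin t *: y))))
  end.

Definition sphere_area (R : realType) (d : nat) : R :=
  sphere_int (fun _ : 'rV[R]_d.+1 => 1).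

Definition mpoly_fun (R : realType) (m : nat) (p : mpoly m R)
  (x : 'rV[R]_m) : R := meval (fun i => x 0 i) p.

Definition laplacian (R : realType) (m : nat) (p : mpoly m R) :
    mpoly m R :=
  \sum_(i < m) mderiv i (mderiv i p).

(* [msize p] is the total degree of p plus one, and 0 for p = 0. *)
Definition sphere_poly (R : realType) (d n : nat) : set ('rV[R]_d.+1 -> R) :=
  [set f | exists2 p : mpoly d.+1 R,
     (msize p <= n.+1)%N & forall x, sphere R d x -> f x = mpoly_fun p x].

Definition sphere_harmonic (R : realType) (d l : nat) :
    set ('rV[R]_d.+1 -> R) :=
  [set f | exists p : mpoly d.+1 R,
     [/\ p \is ishomog1 l mdeg,
         laplacian p = 0 & forall x, sphere R d x -> f x = mpoly_fun p x]].

(* [e] is an L2(S^d)-orthonormal basis of the space [V]. Orthonormality gives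
   linear independence, hence Z = dim V. *)
Definition orthonormal_basis (R : realType) (d Z : nat)
    (V : set ('rV[R]_d.+1 -> R)) (e : 'I_Z -> 'rV[R]_d.+1 -> R) : Prop :=
  [/\ forall k, V (e k),
      forall k k', sphere_int (fun x => e k x * e k' x) = (k == k')%:R &
      forall f, V f -> exists c : 'I_Z -> R,
        forall x, sphere R d x -> f x = \sum_(k < Z) c k * e k x].

(* Gegenbauer polynomial C_l^lam, from the explicit formula
   sum_(k <= l/2) (-1)^k (lam)_(l-k) / (k! (l-2k)!) (2t)^(l-2k),
   with (lam)_m the rising factorial. *)
Definition gegenbauer (R : realType) (lam : R) (l : nat) : {poly R} :=
  \sum_(k < l./2.+1)
    ((- 1) ^+ k * (\prod_(i < l - k) (lam + i%:R))
       / (k`!%:R * (l - k.*2)`!%:R)) *: (2%:R *: 'X) ^+ (l - k.*2).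

Definition zonal_kernel (R : realType) (d l : nat) (t : R) : R :=
  (2 * l%:R + d%:R - 1) / ((d%:R - 1) * sphere_area R d)
    * (gegenbauer ((d%:R - 1) / 2) l).[t].

Definition filter_kernel (R : realType) (d : nat) (a : nat -> nat -> R)
    (n : nat) (t : R) : R :=
  \sum_(l < n.+1) a n l * zonal_kernel d l t.

Definition filter_kernel_conditions (R : realType) (d : nat)
    (a : nat -> nat -> R) : Prop :=
  (forall (n : nat) (x : 'rV[R]_d.+1), (1 <= n)%N -> sphere R d x ->
     sphere_int (fun y => filter_kernel d a n (dot x y)) = 1) /\
  (exists K : R, forall n : nat, (1 <= n)%N ->
     \int[@lebesgue_measure R]_(t in `[0, pi])
       ((1 + n%:R * t) ^+ 2 * `|filter_kernel d a n (cos t)| * sin t ^+ d.-1)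
     <= K).

Definition quadrature (R : realType) (d N : nat) (xs : 'I_N -> 'rV[R]_d.+1)
    (w : 'I_N -> R) (f : 'rV[R]_d.+1 -> R) : R :=
  \sum_(j < N) w j * f (xs j).

Definition has_exactness (R : realType) (d N : nat)
    (xs : 'I_N -> 'rV[R]_d.+1) (w : 'I_N -> R) (m : nat) : Prop :=
  forall p, sphere_poly m p -> quadrature xs w p = sphere_int p.

Definition discrete_inner (R : realType) (d N : nat)
    (xs : 'I_N -> 'rV[R]_d.+1) (w : 'I_N -> R) (f g : 'rV[R]_d.+1 -> R) : R :=
  \sum_(j < N) w j * f (xs j) * g (xs j).

Definition hyperinterp (R : realType) (d N : nat)
    (xs : 'I_N -> 'rV[R]_d.+1) (w : 'I_N -> R) (Z : nat -> nat)
    (Y : forall l : nat, 'I_(Z l) -> 'rV[R]_d.+1 -> R) (n : nat)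
    (f : 'rV[R]_d.+1 -> R) : 'rV[R]_d.+1 -> R :=
  fun x => \sum_(l < n.+1) \sum_(k < Z l)
    discrete_inner xs w f (Y l k) * Y l k x.

Definition gen_hyperinterp (R : realType) (d N : nat)
    (xs : 'I_N -> 'rV[R]_d.+1) (w : 'I_N -> R) (a : nat -> nat -> R) (n : nat)
    (f : 'rV[R]_d.+1 -> R) : 'rV[R]_d.+1 -> R :=
  fun x => \sum_(j < N) w j * f (xs j) * filter_kernel d a n (dot x (xs j)).

(* Main.v *)
Require Import Defs.
From HB Require Import structures.
From mathcomp Require Import all_boot all_order all_algebra.
From mathcomp Require Import ring zify.
From mathcomp Require Import -(notations) mpoly.
From mathcomp Require Import all_classical all_reals all_analysis.
Import Order.TTheory GRing.Theory Num.Theory.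
Import numFieldNormedType.Exports.

(** Hyper self-adjointness is the symmetry of the kernel
    [filter_kernel d a n (dot x y)] in [x] and [y].

    Commutation rests on one fact: [hyperinterp] reproduces on the sphere every
    spherical harmonic of degree at most [n] ([hyperinterp_harmonic]). As each
    [G_l(x . y)] is a spherical harmonic of degree [l] in [x]
    ([sphere_harmonic_zonal]), [L_n] then reproduces the kernels [D_n(. , y)],
    hence their combination [GL_n f], and [L_n (GL_n f) = GL_n f]. In the other
    order, [GL_n h (x)] is the discrete inner product of [h] with [D_n(x , .)];
    [L_n] is self-adjoint for that product, so
    [GL_n (L_n f) (x) = <f, L_n D_n(x , .)> = <f, D_n(x , .)> = GL_n f (x)].

    Reproduction follows from the discrete orthonormality of the [Y l k] with
    [l <= n]. Exactness [2n] turns the discrete products into integrals, so what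
    remains is that harmonics of different degrees are orthogonal for
    [sphere_int] ([sphere_int_harmonic_orthogonal]). The iterated integral
    [sphere_int] has no visible rotation invariance, so the proof goes through
    the identity, for [p] homogeneous of degree [m] in [d + 1] variables,
      [int Lap p = m (m + d - 1) int p]     ([sphere_int_laplacian]),
    which is checked on monomials, whose integrals are products of integrals of
    [cos ^ a * sin ^ b]. If [p] and [q] are harmonic and homogeneous, then
    [Lap (p q) = 2 sum_i d_i p d_i q], and the [d_i p], [d_i q] are harmonic and
    homogeneous of degree one less; induction on the smaller degree ends with
    the derivative of a constant. *)

Set Implicit Arguments.
Unset Strict Implicit.
Local Open Scope classical_set_scope.
Local Open Scope ring_scope.

(** * Integrals of trigonometric monomials *)

Lemma integrable_continuous_segment (R : realType) (a b : R) (f : R -> R) :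
  continuous f ->
  (@lebesgue_measure R).-integrable `[a, b] (EFin \o f).
Proof.
move=> cf; apply: continuous_compact_integrable; first exact: segment_compact.
exact: continuous_subspaceT.
Qed.

Lemma Rintegral_sum_continuous (R : realType) (a b : R) (I : Type) (r : seq I)
    (f : I -> R -> R) : (forall i, continuous (f i)) ->
  \int[@lebesgue_measure R]_(t in `[a, b]) (\sum_(i <- r) f i t) =
  \sum_(i <- r) \int[@lebesgue_measure R]_(t in `[a, b]) f i t.
Proof.
move=> cf; elim: r => [|i r IHr].
  under eq_Rintegral do rewrite big_nil.
  by rewrite big_nil Rintegral_cst//= mul0r.
under eq_Rintegral do rewrite big_cons.
rewrite big_cons -IHr RintegralD//=; first exact: integrable_continuous_segment.
apply: integrable_continuous_segment.
apply: continuous_big => // x; exact: add_continuous.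
Qed.

Definition trig_moment (R : realType) (a b : nat) : R :=
  \int[@lebesgue_measure R]_(t in `[0, pi]) (cos t ^+ a * sin t ^+ b).

Lemma continuous_trig_monomial (R : realType) (a b : nat) :
  continuous (fun t : R => cos t ^+ a * sin t ^+ b).
Proof.
move=> t; apply: cvgM.
- apply: (@continuous_comp _ _ _ cos (fun u : R => u ^+ a)).
    exact: continuous_cos.
  exact: exprn_continuous.
- apply: (@continuous_comp _ _ _ sin (fun u : R => u ^+ b)).
    exact: continuous_sin.
  exact: exprn_continuous.
Qed.

Lemma trig_moment_split (R : realType) (a b : nat) :
  trig_moment R a b = trig_moment R a.+2 b + trig_moment R a b.+2.
Proof.
rewrite /trig_moment -RintegralD//=; last 2 first.
- exact/integrable_continuous_segment/continuous_trig_monomial.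
- exact/integrable_continuous_segment/continuous_trig_monomial.
apply: eq_Rintegral => t _.
have := cos2Dsin2 t; move: (cos t) (sin t) => c s H.
by rewrite !exprSr -!mulrA -!expr2 -[LHS]mulr1 -H; ring.
Qed.

(** [cos ^ a * sin ^ (b + 1)] vanishes at [0] and [pi], so its derivative
    integrates to [0]. For [a = 0] the predecessor is harmless, as it comes with
    the factor [a]; this case says that [cos * sin ^ b] has integral [0]. *)
Lemma trig_moment_parts (R : realType) (a b : nat) :
  b.+1%:R * trig_moment R a.+1 b = a%:R * trig_moment R a.-1 b.+2.
Proof.
apply/eqP; rewrite -subr_eq0 /trig_moment.
have Ii m k : (@lebesgue_measure R).-integrable `[0, pi]
    (EFin \o (fun t => cos t ^+ m * sin t ^+ k)).
  exact/integrable_continuous_segment/continuous_trig_monomial.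
have cI (c : R) m k : continuous (fun t : R => c * (cos t ^+ m * sin t ^+ k)).
  by move=> t; apply: cvgM; [exact: cvg_cst|exact: continuous_trig_monomial].
rewrite -!RintegralZl//= -RintegralB//=; last 2 first.
- exact/integrable_continuous_segment/cI.
- exact/integrable_continuous_segment/cI.
apply/eqP; rewrite /Rintegral.
pose F : R -> R := @cos R ^+ a * @sin R ^+ b.+1.
have FE t : F t = cos t ^+ a * sin t ^+ b.+1 by rewrite /F !fctE.
have dF (t : R) : is_derive t 1 F (b.+1%:R * (cos t ^+ a.+1 * sin t ^+ b) -
    a%:R * (cos t ^+ a.-1 * sin t ^+ b.+2)).
  rewrite /F; apply: is_derive_eq.
  rewrite /GRing.scale/= !fctE !exprS; ring.
have cF : continuous F.
  rewrite (_ : F = fun t => cos t ^+ a * sin t ^+ b.+1); last exact/funext.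
  exact: continuous_trig_monomial.
rewrite (@continuous_FTC2 R _ F)//=.
- by rewrite !FE sin0 sinpi !expr0n/= !mulr0 subrr.
- exact: pi_gt0.
- apply: continuous_subspaceT => t.
  by apply: cvgB; exact: cI.
- split => //.
  + by apply: cvg_at_right_filter; exact: cF.
  + by apply: cvg_at_left_filter; exact: cF.
- by move=> t _; rewrite derive1E; apply: derive_val.
Qed.

(** Effect of the second derivative in [x_0] on the polar factor of the integral
    of a monomial; the factor [a * (a - 1)] covers the truncated [a - 2]. *)
Lemma trig_moment_laplace (R : realType) (a b : nat) :
  a%:R * a.-1%:R * trig_moment R (a - 2) b = a%:R * (a + b)%:R * trig_moment R a b.
Proof.
case: a => [|a]; first by rewrite !mul0r.
have := trig_moment_parts R a b; rewrite -pred_Sn.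
case: a => [|a].
  rewrite mul0r !mulr0 mul0r.
  move/eqP; rewrite mulf_eq0 pnatr_eq0/= => /eqP ->; by rewrite mulr0.
rewrite -pred_Sn subSS subSS subn0 => H.
rewrite -!mulrA; congr (_ * _).
rewrite (trig_moment_split R a b) mulrDr -H -mulrDl -natrD.
by congr (_%:R * _); lia.
Qed.

(** Effect of the Laplacian in the variables other than [x_0], which lowers the
    exponent of the sine by two. *)
Lemma trig_moment_shift (R : realType) (a b : nat) :
  b.+1%:R * trig_moment R a b = (a + b.+2)%:R * trig_moment R a b.+2.
Proof.
rewrite (trig_moment_split R a b) mulrDr trig_moment_parts -mulrDl -natrD.
by congr (_%:R * _); lia.
Qed.

(** * Integrals of monomials over the sphere *)

(** The integral of the monomial of exponents [e]: in spherical coordinates a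
    monomial splits into its polar factor and the monomial of the remaining
    exponents on the sphere of one dimension less. *)
Fixpoint sphere_moment (R : realType) (d : nat) : ('I_d.+1 -> nat) -> R :=
  match d with
  | 0 => fun e => 1 + (- 1) ^+ e ord0
  | d'.+1 => fun e =>
      trig_moment R (e ord0) (d' + \sum_(i < d'.+1) e (lift ord0 i))
      * sphere_moment R (fun i => e (lift ord0 i))
  end.
Arguments sphere_moment R d e : clear implicits.

Lemma row_mx_head (R : realType) (n : nat) (c : R) (v : 'rV[R]_n) (i : 'I_(1 + n)) :
  i = 0%N :> nat -> row_mx (c%:M : 'rV[R]_1) v 0 i = c.
Proof.
move=> i0; rewrite (_ : i = lshift n ord0) ?row_mxEl ?mxE ?eqxx//.
exact: val_inj.
Qed.

Lemma row_mx_tail (R : realType) (n : nat) (c : R) (v : 'rV[R]_n) (i : 'I_(1 + n))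
    (j : 'I_n) :
  i = j.+1 :> nat -> row_mx (c%:M : 'rV[R]_1) v 0 i = v 0 j.
Proof.
move=> ij; rewrite (_ : i = rshift 1 j) ?row_mxEr//; exact: val_inj.
Qed.

(** Stated for finite sums and not for single monomials: the recursive definition
    of [sphere_int] only shows linearity once the inner integral is known to be
    a continuous function of the polar angle. *)
Lemma sphere_int_monomials (R : realType) (d : nat) (I : Type) (r : seq I)
    (c : I -> R) (e : I -> 'I_d.+1 -> nat) :
  sphere_int (fun x : 'rV[R]_d.+1 =>
    \sum_(i <- r) c i * \prod_(j < d.+1) x 0 j ^+ e i j) =
  \sum_(i <- r) c i * sphere_moment R d (e i).
Proof.
elim: d c e => [|d IHd] c e.
  rewrite /= -big_split/=; apply: eq_bigr => i _.
  by rewrite !big_ord1 !mxE expr1n -mulrDr.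
set k := fun i => (d + \sum_(j < d.+1) e i (lift ord0 j))%N.
set M := fun i => sphere_moment R d (fun j => e i (lift ord0 j)).
have slice (t : R) : sin t ^+ d * sphere_int (fun y : 'rV[R]_d.+1 =>
      \sum_(i <- r) c i * \prod_(j < d.+2)
        (row_mx ((cos t)%:M : 'rV[R]_1) (sin t *: y)) 0 j ^+ e i j) =
    \sum_(i <- r) c i * M i * (cos t ^+ e i ord0 * sin t ^+ k i).
  pose c' i :=
    c i * (cos t ^+ e i ord0 * sin t ^+ \sum_(j < d.+1) e i (lift ord0 j)).
  rewrite (_ : (fun y => _) = fun y : 'rV[R]_d.+1 => \sum_(i <- r) c' i *
      \prod_(j < d.+1) y 0 j ^+ e i (lift ord0 j)); last first.
    apply/funext => y; apply: eq_bigr => i _; rewrite big_ord_recl /c' -!mulrA.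
    congr (_ * _).
    rewrite row_mx_head//.
    congr (_ * _); rewrite -prodrXr -big_split/=; apply: eq_bigr => j _.
    by rewrite (@row_mx_tail _ _ _ _ _ j)// mxE exprMn.
  rewrite IHd mulr_sumr; apply: eq_bigr => i _.
  by rewrite /c' /k /M exprD; ring.
rewrite [LHS]/=.
under eq_Rintegral do rewrite slice.
rewrite Rintegral_sum_continuous; last first.
  move=> i t; apply: cvgM; [exact: cvg_cst|exact: continuous_trig_monomial].
apply: eq_bigr => i _; rewrite RintegralZl//=; last first.
  exact/integrable_continuous_segment/continuous_trig_monomial.
by rewrite -/(trig_moment R (e i ord0) (k i)) -mulrA [M i * _]mulrC.
Qed.

(** The identity [int Lap p = m (m + d - 1) int p] for a monomial, by induction on
    the dimension. In the step from [d] to [d + 1], with [a] the exponent of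
    [x_0], [k] the sum of the others and [W], [M] the polar factor and the
    remaining moment, the derivative in [x_0] contributes [a (a + d + k) W M]
    and the others, by induction and [trig_moment_shift], [k (a + d + k) W M]. *)
Lemma sphere_moment_laplace (R : realType) (d : nat) (e : 'I_d.+1 -> nat) :
  \sum_(i < d.+1) (e i)%:R * (e i).-1%:R *
    sphere_moment R d (fun j => (e j - (j == i).*2)%N) =
  (\sum_(i < d.+1) e i)%:R * ((\sum_(i < d.+1) e i)%:R + d%:R - 1) *
    sphere_moment R d e.
Proof.
elim: d e => [|d IHd] e.
  rewrite !big_ord1 addr0 /=.
  case: (e ord0) => [|[|m]]; rewrite ?subSS ?subn0 -?pred_Sn; try by ring.
  rewrite !exprS -[m.+2%:R]natr1; ring.
set e' := fun i => e (lift ord0 i); set k := (\sum_i e' i)%N.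
set M := sphere_moment R d e'.
have -> : (\sum_i e i = e ord0 + k)%N by rewrite big_ord_recl.
rewrite big_ord_recl.
have head : sphere_moment R d.+1 (fun j => (e j - (j == ord0).*2)%N) =
    trig_moment R (e ord0 - 2) (d + k) * M.
  rewrite /=; congr (_ * _).
    by congr (trig_moment _ _ (d + _)%N); apply: eq_bigr => i _; rewrite subn0.
  by congr (sphere_moment _ _ _); apply/funext => i; rewrite subn0.
have tail i : (e' i)%:R * (e' i).-1%:R *
      sphere_moment R d.+1 (fun j => (e j - (j == lift ord0 i).*2)%N) =
    trig_moment R (e ord0) (d + (k - 2)) * ((e' i)%:R * (e' i).-1%:R *
      sphere_moment R d (fun j => (e' j - (j == i).*2)%N)).
  have [e2|] := leqP 2 (e' i); last first.
    by case: (e' i) => [|[]]// _; rewrite !(mulr0, mul0r).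
  rewrite [sphere_moment R d.+1 _]/= subn0 [RHS]mulrCA.
  congr (_ * (trig_moment _ _ _ * _)); congr (d + _)%N.
  rewrite /k (bigD1 i)//= [in RHS](bigD1 i)//= -/(e' i) eqxx -addnBAC//.
  congr (_ + _)%N.
  by apply: eq_bigr => j /negPf ji; rewrite -[lift _ _ == _]/(j == i) ji subn0.
rewrite head (eq_bigr _ (fun i _ => tail i)) -mulr_sumr IHd -/k -/M.
have -> : sphere_moment R d.+1 e = trig_moment R (e ord0) (d + k) * M by [].
rewrite !mulrA trig_moment_laplace.
suff : trig_moment R (e ord0) (d + (k - 2)) * k%:R * (k%:R + d%:R - 1) * M =
    k%:R * (e ord0 + (d + k))%:R * trig_moment R (e ord0) (d + k) * M.
  by rewrite !natrD -[d.+1%:R]natr1 => ->; ring.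
(* For [k = 1] there is no power of the sine to shift, but then [M = 0]: by the
   induction hypothesis if [d > 0], and by parity on the two points of S^0. *)
case: (k =P 1%N) => [k1|].
  suff -> : M = 0 by rewrite !mulr0.
  have := IHd e'; rewrite -/k -/M k1 mul1r addrAC subrr add0r big1.
    move/esym/eqP; rewrite mulf_eq0 pnatr_eq0 => /orP[/eqP d0|/eqP//].
    rewrite /M; move: k1; rewrite /k; move: e' {k M head tail} => /=.
    move: d0 {IHd e} => -> e'.
    by rewrite big_ord1 => /= ->; rewrite expr1 subrr.
  move=> i _; have : (e' i <= 1)%N by rewrite -k1 /k (bigD1 i)//= leq_addr.
  by case: (e' i) => [|[]]// _; rewrite !(mulr0, mul0r).
case: k {head tail} => [|[|k]]// _; first by rewrite ?(mul0r, mulr0).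
congr (_ * _).
rewrite !subSS subn0 !addnS. 
have := trig_moment_shift R (e ord0) (d + k); rewrite !addnS => H.
transitivity (k.+2%:R * ((d + k).+1%:R * trig_moment R (e ord0) (d + k))).
 rewrite -!natr1 natrD; ring.
by rewrite H; ring.
Qed.

(** * Integrals of Laplacians over the sphere *)

Definition sphere_int_mpoly (R : realType) (d : nat) (p : mpoly d.+1 R) : R :=
  sphere_int (mpoly_fun p).

(** Summing over all monomials of bounded degree, and not over the support of
    [p], makes linearity in [p] visible. *)
Lemma sphere_int_mpolywE (R : realType) (d k : nat) (p : mpoly d.+1 R) :
  (msize p <= k)%N ->
  sphere_int_mpoly p =
  \sum_(m : bmultinom d.+1 k) mcoeff m p * sphere_moment R d (fun j => bmnm m j).
Proof.
move=> pk; rewrite -sphere_int_monomials /sphere_int_mpoly; congr sphere_int.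
apply/funext => x; rewrite /mpoly_fun {1}(mpolywE pk) raddf_sum/=.
by apply: eq_bigr => m _; rewrite mevalZ mevalX.
Qed.

Fact sphere_int_mpoly_is_linear (R : realType) (d : nat) :
  linear_for *%R (@sphere_int_mpoly R d).
Proof.
move=> c p q; pose k := maxn (msize (c *: p + q)) (maxn (msize p) (msize q)).
rewrite !(@sphere_int_mpolywE _ _ k) ?leq_max ?leqnn ?orbT//.
rewrite mulr_sumr -big_split/=; apply: eq_bigr => m _.
by rewrite mcoeffD mcoeffZ mulrDl mulrA.
Qed.

HB.instance Definition _ (R : realType) (d : nat) :=
  GRing.isLinear.Build R (mpoly d.+1 R) R *%R (@sphere_int_mpoly R d)
    (@sphere_int_mpoly_is_linear R d).

Lemma sphere_int_mpolyX (R : realType) (d : nat) (m : multinom d.+1) :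
  sphere_int_mpoly (mpolyX R m) = sphere_moment R d m.
Proof.
have := @sphere_int_monomials R d unit [:: tt] (fun=> 1) (fun=> m).
rewrite !big_seq1 mul1r => <-; congr sphere_int.
by apply/funext => x; rewrite /mpoly_fun mevalX big_seq1 mul1r.
Qed.

Fact laplacian_is_linear (R : realType) (n : nat) : linear (@laplacian R n).
Proof.
move=> c p q; rewrite /laplacian scaler_sumr -big_split/=.
by apply: eq_bigr => i _; rewrite !linearP.
Qed.

HB.instance Definition _ (R : realType) (n : nat) :=
  GRing.isLinear.Build R (mpoly n R) (mpoly n R) *:%R (@laplacian R n)
    (@laplacian_is_linear R n).

Lemma laplacianX (R : realType) (n : nat) (m : multinom n) :
  laplacian (mpolyX R m) =
  \sum_(i < n) ((m i)%:R * (m i).-1%:R) *: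
    mpolyX R (mnm_sub (mnm_sub m (mnm1 i)) (mnm1 i)).
Proof.
apply: eq_bigr => i _; rewrite mderivX linearZ/= mderivX scalerA.
by rewrite mnmBE mnm1E eqxx subn1.
Qed.

(** On the sphere, the Laplacian and the radial part [m (m + d - 1) p] differ by
    the spherical Laplacian, whose integral is [0]. The proof checks monomials. *)
Lemma sphere_int_laplacian (R : realType) (d m : nat) (p : mpoly d.+1 R) :
  p \is ishomog1 m mdeg ->
  sphere_int_mpoly (laplacian p) =
  m%:R * (m%:R + d%:R - 1) * sphere_int_mpoly p.
Proof.
move=> /dhomogP homp; rewrite [p]mpolyE (raddf_sum (@laplacian R d.+1)).
rewrite !raddf_sum mulr_sumr /=.
rewrite !big_seq; apply: eq_bigr => k kp; rewrite !linearZ/= mulrCA; congr (_ * _).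
rewrite laplacianX raddf_sum/= sphere_int_mpolyX.
have <- : mdeg k = m by exact: homp.
rewrite mdegE.
rewrite -sphere_moment_laplace; apply: eq_bigr => i _.
rewrite linearZ/= sphere_int_mpolyX; congr (_ * sphere_moment _ _ _).
by apply/funext => j; rewrite !mnmBE !mnm1E -subnDA addnn eq_sym.
Qed.

(** * Orthogonality of harmonic polynomials *)

Definition grad_dot (R : realType) (n : nat) (p q : mpoly n R) : mpoly n R :=
  \sum_(i < n) mderiv i p * mderiv i q.

Lemma laplacianM (R : realType) (n : nat) (p q : mpoly n R) :
  laplacian (p * q) = laplacian p * q + p * laplacian q + 2%:R * grad_dot p q.
Proof.
rewrite /laplacian /grad_dot mulr_suml !mulr_sumr -!big_split/=.
by apply: eq_bigr => i _; rewrite !mderivM mderivD !mderivM; ring.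
Qed.

Lemma laplacian_mderiv (R : realType) (n : nat) (i : 'I_n) (p : mpoly n R) :
  laplacian (mderiv i p) = mderiv i (laplacian p).
Proof.
rewrite /laplacian raddf_sum; apply: eq_bigr => j _.
by rewrite (mderiv_comm i j p) (mderiv_comm i j).
Qed.

Lemma homog_mderiv (R : realType) (n l : nat) (i : 'I_n) (p : mpoly n R) :
  p \is ishomog1 l.+1 mdeg -> mderiv i p \is ishomog1 l mdeg.
Proof.
move=> homp; apply/dhomogP => m; rewrite mcoeff_msupp mcoeff_deriv => pm.
have : mnm_add m (mnm1 i) \in msupp p.
  by rewrite mcoeff_msupp; apply: contraNneq pm => ->; rewrite mul0rn.
by move=> /(dhomog_mf homp) /=; rewrite mdegD mdeg1 addn1 => -[].
Qed.

Lemma mderiv_homog0 (R : realType) (n : nat) (i : 'I_n) (p : mpoly n R) :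
  p \is ishomog1 0 mdeg -> mderiv i p = 0.
Proof.
move=> homp; apply/mpolyP => m; rewrite mcoeff_deriv mcoeff0.
rewrite (dhomog_nemf_coeff homp) ?mul0rn//.
by rewrite /= mdegD mdeg1 addn1.
Qed.

(** The integral of [p q] is a nonzero multiple of that of
    [Lap (p q) = 2 sum_i d_i p d_i q], to which induction applies. The strict
    inequality [l < l'] makes the multiple nonzero and persists down to [l = 0],
    where the [d_i p] vanish. *)
Lemma sphere_int_harmonic_orthogonal (R : realType) (d l l' : nat)
    (p q : mpoly d.+1 R) : (0 < d)%N -> (l < l')%N ->
  p \is ishomog1 l mdeg -> q \is ishomog1 l' mdeg ->
  laplacian p = 0 -> laplacian q = 0 -> sphere_int_mpoly (p * q) = 0.
Proof.
move=> d0; have nz m : (m.+1%:R + d%:R - 1 == 0 :> R) = false.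
  by rewrite -natr1 addrAC addrK -natrD pnatr_eq0 addn_eq0 (gtn_eqF d0) andbF.
elim: l l' p q => [|l IHl] [|l']// p q ll' homp homq lp lq.
all: have := sphere_int_laplacian (dhomogM homp homq).
all: rewrite laplacianM lp lq mul0r mulr0 !add0r mulr_natl raddfMn raddf_sum/=.
all: rewrite big1 ?mul0rn; [|move=> i _].
all: try by [rewrite mderiv_homog0// mul0r raddf0 |
  apply: (IHl l'); rewrite ?homog_mderiv ?laplacian_mderiv ?lp ?lq ?raddf0].
all: move=> /esym/eqP; rewrite addnS mulf_eq0 => /orP[|/eqP//].
all: by rewrite mulf_eq0 pnatr_eq0 nz.
Qed.

(** * Zonal harmonics *)

Lemma mderivXn (R : realType) (n k : nat) (i : 'I_n) (p : mpoly n R) :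
  mderiv i (p ^+ k) = k%:R * p ^+ k.-1 * mderiv i p.
Proof.
elim: k => [|k IHk]; first by rewrite expr0 !mul0r mderivC.
rewrite exprS mderivM IHk; case: k {IHk} => [|k]; first by rewrite !expr0; ring.
by rewrite -!pred_Sn !exprS -[k.+2%:R]natr1; ring.
Qed.

Lemma grad_dotXn (R : realType) (n j k : nat) (p q : mpoly n R) :
  grad_dot (p ^+ j) (q ^+ k) =
  (j * k)%:R * p ^+ j.-1 * q ^+ k.-1 * grad_dot p q.
Proof.
rewrite /grad_dot mulr_sumr; apply: eq_bigr => i _.
by rewrite !mderivXn natrM; ring.
Qed.

Lemma laplacianXn (R : realType) (n k : nat) (p : mpoly n R) :
  laplacian (p ^+ k) = k%:R * p ^+ k.-1 * laplacian p +
    (k * k.-1)%:R * p ^+ k.-2 * grad_dot p p.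
Proof.
rewrite /laplacian /grad_dot !mulr_sumr -big_split/=; apply: eq_bigr => i _.
rewrite mderivXn !mderivM mderivXn natrM.
rewrite -mpolyC_nat mderivC; ring.
Qed.

Definition linear_mpoly (R : realType) (n : nat) (y : 'rV[R]_n) : mpoly n R :=
  \sum_(i < n) y 0 i *: mpolyX R (mnm1 i).

Definition sqnorm_mpoly (R : realType) (n : nat) : mpoly n R :=
  \sum_(i < n) mpolyX R (mnm1 i) ^+ 2.
Arguments sqnorm_mpoly R n : clear implicits.

Lemma mderivXU (R : realType) (n : nat) (i j : 'I_n) :
  mderiv i (mpolyX R (mnm1 j)) = (i == j)%:R.
Proof.
rewrite mderivX mnm1E eq_sym; case: eqP => [->|]; last by rewrite scale0r.
rewrite scale1r (_ : mnm_sub _ _ = mnm0) ?mpolyX0//.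
by apply/mnmP => k; rewrite mnmBE subnn mnm0E.
Qed.

Lemma mderiv_linear_mpoly (R : realType) (n : nat) (y : 'rV[R]_n) (i : 'I_n) :
  mderiv i (linear_mpoly y) = mpolyC n (y 0 i).
Proof.
rewrite /linear_mpoly raddf_sum (bigD1 i)//= big1 => [|j /negPf ji].
  by rewrite linearZ/= mderivXU eqxx addr0 -mul_mpolyC mulr1.
by rewrite linearZ/= mderivXU eq_sym ji scaler0.
Qed.

Lemma mderiv_sqnorm_mpoly (R : realType) (n : nat) (i : 'I_n) :
  mderiv i (sqnorm_mpoly R n) = 2%:R * mpolyX R (mnm1 i).
Proof.
rewrite /sqnorm_mpoly raddf_sum (bigD1 i)//= big1 => [|j /negPf ji].
  by rewrite mderivXn mderivXU eqxx addr0 mulr1.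
by rewrite mderivXn mderivXU eq_sym ji mulr0.
Qed.

Lemma laplacian_linear_mpoly (R : realType) (n : nat) (y : 'rV[R]_n) :
  laplacian (linear_mpoly y) = 0.
Proof. by apply: big1 => i _; rewrite mderiv_linear_mpoly mderivC. Qed.

Lemma laplacian_sqnorm_mpoly (R : realType) (n : nat) :
  laplacian (sqnorm_mpoly R n) = (2 * n)%:R.
Proof.
rewrite /laplacian (eq_bigr (fun=> 2%:R)) => [|i _].
  by rewrite sumr_const card_ord mulrnA.
rewrite mderiv_sqnorm_mpoly -mpolyC_nat mul_mpolyC linearZ/= mderivXU eqxx.
by rewrite -mul_mpolyC mulr1.
Qed.

Lemma grad_dot_linear_mpoly (R : realType) (n : nat) (y : 'rV[R]_n) :
  grad_dot (linear_mpoly y) (linear_mpoly y) = mpolyC n (dot y y).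
Proof.
rewrite /dot raddf_sum; apply: eq_bigr => i _.
by rewrite mderiv_linear_mpoly /= mpolyCM.
Qed.

Lemma grad_dot_linear_sqnorm (R : realType) (n : nat) (y : 'rV[R]_n) :
  grad_dot (linear_mpoly y) (sqnorm_mpoly R n) = 2%:R * linear_mpoly y.
Proof.
rewrite /linear_mpoly mulr_sumr; apply: eq_bigr => i _.
by rewrite mderiv_linear_mpoly mderiv_sqnorm_mpoly -mul_mpolyC; ring.
Qed.

Lemma grad_dot_sqnorm (R : realType) (n : nat) :
  grad_dot (sqnorm_mpoly R n) (sqnorm_mpoly R n) = 4%:R * sqnorm_mpoly R n.
Proof.
rewrite {3}/sqnorm_mpoly mulr_sumr; apply: eq_bigr => i _.
by rewrite !mderiv_sqnorm_mpoly; ring.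
Qed.

(** With [u = x . y] and [r = |x|^2], the gradient products are
    [grad u . grad u = |y|^2 = 1], [grad u . grad r = 2 u] and
    [grad r . grad r = 4 r], so the Laplacian stays in the span of the
    [u^j r^k]. *)
Lemma laplacian_zonal_monomial (R : realType) (n j k : nat) (y : 'rV[R]_n) :
  dot y y = 1 ->
  laplacian (linear_mpoly y ^+ j * sqnorm_mpoly R n ^+ k) =
  (j * j.-1)%:R * (linear_mpoly y ^+ j.-2 * sqnorm_mpoly R n ^+ k) +
  (2 * k * (n + 2 * j + 2 * k.-1))%:R *
    (linear_mpoly y ^+ j * sqnorm_mpoly R n ^+ k.-1).
Proof.
move=> y1; rewrite laplacianM !laplacianXn grad_dotXn.
rewrite laplacian_linear_mpoly grad_dot_linear_mpoly y1 laplacian_sqnorm_mpoly.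
rewrite grad_dot_linear_sqnorm grad_dot_sqnorm mpolyC1.
move: (linear_mpoly y) (sqnorm_mpoly R n) => u r.
case: j => [|j]; case: k => [|[|k]]; rewrite -?pred_Sn ?expr0 ?muln0 ?mul0n.
all: rewrite ?(exprS u) ?(exprS r).
all: ring.
Qed.

(** The coefficient of [t ^ (l - 2 k)] in the Gegenbauer polynomial. *)
Definition gegenbauer_coef (R : realType) (lam : R) (l k : nat) : R :=
  (- 1) ^+ k * (\prod_(i < l - k) (lam + i%:R)) / (k`!%:R * (l - k.*2)`!%:R)
    * 2%:R ^+ (l - k.*2).

Lemma gegenbauer_horner (R : realType) (lam : R) (l : nat) (t : R) :
  (gegenbauer lam l).[t] =
  \sum_(k < l./2.+1) gegenbauer_coef lam l k * t ^+ (l - k.*2).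
Proof.
rewrite horner_sum; apply: eq_bigr => k _.
by rewrite hornerZ horner_exp hornerZ hornerX exprMn mulrA.
Qed.

(** The recurrence that makes [zonal_mpoly] harmonic. It is stated for
    [l = m + 2 + 2 k], so that no truncated subtraction is left. *)
Lemma gegenbauer_coefS (R : realType) (lam : R) (m k : nat) :
  gegenbauer_coef lam (m.+2 + k.*2) k * (m.+2 * m.+1)%:R =
  - (gegenbauer_coef lam (m.+2 + k.*2) k.+1 *
     (4 * k.+1%:R * (lam + m%:R + k%:R + 1))).
Proof.
rewrite /gegenbauer_coef.
have -> : (m.+2 + k.*2 - k.*2 = m.+2)%N by lia.
have -> : (m.+2 + k.*2 - k.+1.*2 = m)%N by lia.
have -> : (m.+2 + k.*2 - k = (m + k).+2)%N by lia.
have -> : (m.+2 + k.*2 - k.+1 = (m + k).+1)%N by lia.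
rewrite big_ord_recr/= !factS !natrM !exprS.
have fm : m`!%:R != 0 :> R by rewrite pnatr_eq0 -lt0n fact_gt0.
have fk : k`!%:R != 0 :> R by rewrite pnatr_eq0 -lt0n fact_gt0.
have m1 : m.+1%:R != 0 :> R by rewrite pnatr_eq0.
have m2 : m.+2%:R != 0 :> R by rewrite pnatr_eq0.
have k1 : k.+1%:R != 0 :> R by rewrite pnatr_eq0.
rewrite -natr1 natrD; field.
by rewrite fm fk !nat1r -(natrD _ 2) k1 m1 m2.
Qed.

(** The homogeneous extension [|x|^l C_l(x . y / |x|)] of the Gegenbauer
    polynomial, for [|y| = 1]. *)
Definition zonal_mpoly (R : realType) (n : nat) (lam : R) (l : nat)
    (y : 'rV[R]_n) : mpoly n R :=
  \sum_(k < l./2.+1) gegenbauer_coef lam l k *: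
    (linear_mpoly y ^+ (l - k.*2) * sqnorm_mpoly R n ^+ k).

Lemma homog_mpolyXU (R : realType) (n : nat) (i : 'I_n) :
  mpolyX R (mnm1 i) \is ishomog1 1 mdeg.
Proof. by rewrite dhomogX /= mdeg1. Qed.

Lemma homog_zonal_mpoly (R : realType) (n : nat) (lam : R) (l : nat)
    (y : 'rV[R]_n) : zonal_mpoly lam l y \is ishomog1 l mdeg.
Proof.
have hu : linear_mpoly y \is ishomog1 1 mdeg.
  by apply: rpred_sum => i _; apply: rpredZ; exact: homog_mpolyXU.
have hr : sqnorm_mpoly R n \is ishomog1 2 mdeg.
  by apply: rpred_sum => i _; exact: (dhomogMn 2 (homog_mpolyXU R i)).
apply: rpred_sum => k _; apply: rpredZ.
have kl : (1 * (l - k.*2) + 2 * k = l)%N by have := ltn_ord k; lia.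
by have := dhomogM (dhomogMn (l - k.*2) hu) (dhomogMn k hr); rewrite kl.
Qed.

(** The two terms of [laplacian_zonal_monomial] telescope: the first one for the
    index [k] cancels the second one for [k + 1]. *)
Lemma laplacian_zonal_mpoly (R : realType) (n : nat) (lam : R) (l : nat)
    (y : 'rV[R]_n) : n%:R = 2 * lam + 2 -> dot y y = 1 ->
  laplacian (zonal_mpoly lam l y) = 0.
Proof.
move=> nlam y1; rewrite /zonal_mpoly (raddf_sum (@laplacian R n)).
under eq_bigr do rewrite /= linearZ /= laplacian_zonal_monomial // scalerDr.
(* The boundary terms vanish: the last of the first sum since there
   [l - 2 k <= 1], and the first of the second sum since there [k = 0]. *)
rewrite big_split /= big_ord_recr [X in _ + X]big_ord_recl /=.
have -> : ((l - l./2.*2) * (l - l./2.*2).-1 = 0)%N.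
  have : (l - l./2.*2 <= 1)%N by lia.
  by case: (l - l./2.*2)%N => [|[]].
rewrite muln0 mul0n !mul0r !scaler0 addr0 add0r -big_split/=.
apply: big1 => k _; have := ltn_ord k => kl.
rewrite /bump /= add1n add0n.
have [m lE] : exists m, l = (m.+2 + k.*2)%N.
  by exists (l - k.*2 - 2)%N; lia.
have -> : (l - k.*2 = m.+2)%N by lia.
have -> : (l - k.+1.*2 = m)%N by lia.
rewrite -pred_Sn -[m.+2.-2]/m -!mpolyC_nat !mul_mpolyC !scalerA -scalerDl.
have := gegenbauer_coefS lam m k; rewrite -lE => ->.
rewrite !(natrM, natrD) nlam [X in X *: _](_ : _ = 0) ?scale0r//; ring.
Qed.

Lemma mevalXn (R : realType) (n k : nat) (v : 'I_n -> R) (p : mpoly n R) :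
  meval v (p ^+ k) = meval v p ^+ k.
Proof.
by elim: k => [|k IHk]; rewrite ?expr0 ?meval1// !exprS mevalM IHk.
Qed.

Lemma mpoly_fun_zonal (R : realType) (d : nat) (lam : R) (l : nat)
    (x y : 'rV[R]_d.+1) : sphere R d x ->
  mpoly_fun (zonal_mpoly lam l y) x = (gegenbauer lam l).[dot x y].
Proof.
move=> x1; rewrite gegenbauer_horner /mpoly_fun raddf_sum /=.
apply: eq_bigr => k _; rewrite mevalZ mevalM !mevalXn; congr (_ * _).
have -> : meval (x 0) (sqnorm_mpoly R d.+1) = 1.
  rewrite -[RHS]x1 raddf_sum; apply: eq_bigr => i _.
  by rewrite /= mevalXn mevalXU.
rewrite expr1n mulr1; congr (_ ^+ _); rewrite raddf_sum.
by apply: eq_bigr => i _; rewrite /= mevalZ mevalXU mulrC.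
Qed.

Lemma sphere_harmonic_zonal (R : realType) (d l : nat) (y : 'rV[R]_d.+1) :
  sphere R d y ->
  sphere_harmonic l (fun x => zonal_kernel d l (dot x y)).
Proof.
move=> y1.
exists ((2 * l%:R + d%:R - 1) / ((d%:R - 1) * sphere_area R d) *:
  zonal_mpoly ((d%:R - 1) / 2) l y); split.
- by apply: rpredZ; exact: homog_zonal_mpoly.
- rewrite linearZ /= laplacian_zonal_mpoly ?scaler0// -natr1; by field.
- move=> x x1; rewrite /mpoly_fun mevalZ.
  by rewrite -[meval _ _]/(mpoly_fun _ x) mpoly_fun_zonal.
Qed.

(** * Discrete inner product and hyperinterpolation *)

Lemma homog_msize_le (R : realType) (n l : nat) (p : mpoly n R) :
  p \is ishomog1 l mdeg -> (msize p <= l.+1)%N.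
Proof.
move=> homp; rewrite msizeE; apply/bigmax_leqP_seq => m mp _.
by rewrite ltnS (dhomog_mf homp mp : mdeg m = l).
Qed.

Lemma dotC (R : realType) (m : nat) (x y : 'rV[R]_m) : dot x y = dot y x.
Proof. by apply: eq_bigr => i _; rewrite mulrC. Qed.

Lemma discrete_innerE (R : realType) (d N : nat) (xs : 'I_N -> 'rV[R]_d.+1)
    (w : 'I_N -> R) (f g : 'rV[R]_d.+1 -> R) :
  discrete_inner xs w f g = quadrature xs w (fun x => f x * g x).
Proof. by apply: eq_bigr => j _; rewrite mulrA. Qed.

Lemma discrete_innerC (R : realType) (d N : nat) (xs : 'I_N -> 'rV[R]_d.+1)
    (w : 'I_N -> R) (f g : 'rV[R]_d.+1 -> R) :
  discrete_inner xs w f g = discrete_inner xs w g f.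
Proof. by apply: eq_bigr => j _; rewrite mulrAC. Qed.

Lemma eq_discrete_inner (R : realType) (d N : nat) (xs : 'I_N -> 'rV[R]_d.+1)
    (w : 'I_N -> R) (f f' g g' : 'rV[R]_d.+1 -> R) :
  (forall j, sphere R d (xs j)) ->
  (forall x, sphere R d x -> f x = f' x) ->
  (forall x, sphere R d x -> g x = g' x) ->
  discrete_inner xs w f g = discrete_inner xs w f' g'.
Proof. by move=> hxs ff' gg'; apply: eq_bigr => j _; rewrite ff' ?gg'. Qed.

Lemma discrete_inner_suml (R : realType) (d N : nat) (xs : 'I_N -> 'rV[R]_d.+1)
    (w : 'I_N -> R) (I : Type) (r : seq I) (c : I -> R)
    (F : I -> 'rV[R]_d.+1 -> R) (g : 'rV[R]_d.+1 -> R) :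
  discrete_inner xs w (fun x => \sum_(i <- r) c i * F i x) g =
  \sum_(i <- r) c i * discrete_inner xs w (F i) g.
Proof.
rewrite /discrete_inner.
under [RHS]eq_bigr do rewrite mulr_sumr.
rewrite exchange_big/=; apply: eq_bigr => j _.
by rewrite mulr_sumr mulr_suml; apply: eq_bigr => i _; ring.
Qed.

Section Hyperinterpolation.
Variables (R : realType) (d : nat) (Z : nat -> nat).
Variables (Y : forall l : nat, 'I_(Z l) -> 'rV[R]_d.+1 -> R).
Variables (N : nat) (xs : 'I_N -> 'rV[R]_d.+1) (w : 'I_N -> R) (n : nat).
Hypothesis hxs : forall j, sphere R d (xs j).
Local Notation inner := (discrete_inner xs w).
Local Notation hyper := (hyperinterp xs w Y n).

Lemma hyperinterp_sum (I : Type) (r : seq I) (c : I -> R)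
    (F : I -> 'rV[R]_d.+1 -> R) (x : 'rV[R]_d.+1) :
  hyper (fun x => \sum_(i <- r) c i * F i x) x =
  \sum_(i <- r) c i * hyper (F i) x.
Proof.
rewrite /hyperinterp.
under [RHS]eq_bigr do rewrite mulr_sumr.
rewrite exchange_big/=; apply: eq_bigr => l _.
under [RHS]eq_bigr do rewrite mulr_sumr.
rewrite exchange_big/=; apply: eq_bigr => k _.
by rewrite discrete_inner_suml mulr_suml; apply: eq_bigr => i _; ring.
Qed.

Lemma hyperinterp_self_adjoint (f g : 'rV[R]_d.+1 -> R) :
  inner (hyper f) g = inner f (hyper g).
Proof.
have E h h' : inner (hyper h) h' =
    \sum_(l < n.+1) \sum_(k < Z l) inner h (Y k) * inner (Y k) h'.
  rewrite /hyperinterp.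
  rewrite (_ : (fun x => _) = fun x : 'rV[R]_d.+1 =>
      \sum_(l < n.+1) 1 * \sum_(k < Z l) inner h (Y k) * Y k x); last first.
    by apply/funext => x; apply: eq_bigr => l _; rewrite mul1r.
  rewrite discrete_inner_suml; apply: eq_bigr => l _.
  by rewrite mul1r discrete_inner_suml.
rewrite E discrete_innerC E; apply: eq_bigr => l _; apply: eq_bigr => k _.
by rewrite mulrC discrete_innerC (discrete_innerC _ _ f).
Qed.

Hypothesis d0 : (0 < d)%N.
Hypothesis exact_xs : has_exactness xs w (2 * n)%N.

Lemma sphere_poly_harmonicM (l l' : nat) (f g : 'rV[R]_d.+1 -> R) :
  (l <= n)%N -> (l' <= n)%N -> sphere_harmonic l f -> sphere_harmonic l' g ->
  sphere_poly (2 * n) (fun x => f x * g x).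
Proof.
move=> ln l'n [p [homp _ fp]] [q [homq _ gq]]; exists (p * q).
  by apply: leq_trans (homog_msize_le (dhomogM homp homq)) _; lia.
by move=> x x1; rewrite fp// gq// /mpoly_fun mevalM.
Qed.

Lemma discrete_inner_harmonic_orthogonal (l l' : nat) (f g : 'rV[R]_d.+1 -> R) :
  (l <= n)%N -> (l' <= n)%N -> l != l' ->
  sphere_harmonic l f -> sphere_harmonic l' g -> inner f g = 0.
Proof.
wlog ll' : l l' f g / (l < l')%N => [H|] ln l'n.
  rewrite neq_ltn => /orP[ll'|l'l] hf hg.
    by apply: (H l l'); rewrite // neq_ltn ll'.
  by rewrite discrete_innerC; apply: (H l' l); rewrite // neq_ltn l'l.
move=> _ [p [homp lapp fp]] [q [homq lapq gq]].
(* [f] and [g] are known on the sphere only, so they are replaced by [p] and [q]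
   while the sum over the nodes has not yet become an integral. *)
rewrite (eq_discrete_inner _ hxs fp gq) discrete_innerE exact_xs; last first.
  by apply: (sphere_poly_harmonicM ln l'n); [exists p | exists q].
rewrite -[RHS](sphere_int_harmonic_orthogonal d0 ll' homp homq lapp lapq).
by congr sphere_int; apply/funext => x; rewrite /mpoly_fun mevalM.
Qed.

Hypothesis basis_Y :
  forall l, orthonormal_basis (@sphere_harmonic R d l) (@Y l).

(** Expanding [f] in the basis [Y l] leaves only its own coefficients: the basis
    functions of other degrees are discretely orthogonal to [f], and those of
    degree [l] are discretely orthonormal. *)
Lemma hyperinterp_harmonic (l : nat) (f : 'rV[R]_d.+1 -> R)
    (x : 'rV[R]_d.+1) : (l <= n)%N -> sphere_harmonic l f -> sphere R d x ->
  hyper f x = f x.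
Proof.
move=> ln hf x1; have [HY orthoY spanY] := basis_Y l.
have [c fc] := spanY _ hf.
rewrite /hyperinterp (bigD1 (Ordinal (ln : (l < n.+1)%N)))//= [X in _ + X]big1.
  rewrite addr0 fc//; apply: eq_bigr => k _; congr (_ * _).
  rewrite (eq_discrete_inner (g' := Y k) _ hxs fc)// discrete_inner_suml.
  rewrite (bigD1 k)//= big1 => [|k' /negPf k'k].
    rewrite discrete_innerE exact_xs ?orthoY ?eqxx ?mulr1 ?addr0//.
    exact: (sphere_poly_harmonicM ln ln).
  rewrite discrete_innerE exact_xs ?orthoY ?k'k ?mulr0//.
  exact: (sphere_poly_harmonicM ln ln).
move=> l' l'l; apply: big1 => k _; have [HY' _ _] := basis_Y l'.
rewrite (discrete_inner_harmonic_orthogonal ln _ _ hf (HY' k)) ?mul0r//.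
  by rewrite -ltnS.
by rewrite eq_sym.
Qed.

Lemma hyperinterp_filter_kernel (a : nat -> nat -> R) (x y : 'rV[R]_d.+1) :
  sphere R d x -> sphere R d y ->
  hyper (fun z => filter_kernel d a n (dot z y)) x =
  filter_kernel d a n (dot x y).
Proof.
move=> x1 y1; rewrite hyperinterp_sum; apply: eq_bigr => l _; congr (_ * _).
apply: (@hyperinterp_harmonic l); rewrite // -1?ltnS//.
exact: sphere_harmonic_zonal.
Qed.

End Hyperinterpolation.

Theorem theorem3p2 (R : realType) (d : nat) (hd : (2 <= d)%N)
  (Z : nat -> nat) (Y : forall l : nat, 'I_(Z l) -> 'rV[R]_d.+1 -> R)
  (hY : forall l : nat, orthonormal_basis (@sphere_harmonic R d l) (Y l))
  (a : nat -> nat -> R) (ha : filter_kernel_conditions d a)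
  (n : nat) (hn : (1 <= n)%N)
  (N : nat) (xs : 'I_N -> 'rV[R]_d.+1) (w : 'I_N -> R)
  (hxs : forall j : 'I_N, sphere R d (xs j)) (hw : forall j : 'I_N, 0 < w j)
  (hexact : has_exactness xs w (2 * n)%N)
  (f g : 'rV[R]_d.+1 -> R)
  (hf : {within sphere R d, continuous f})
  (hg : {within sphere R d, continuous g}) :
  discrete_inner xs w (gen_hyperinterp xs w a n f) g =
    discrete_inner xs w f (gen_hyperinterp xs w a n g) /\
  (forall x : 'rV[R]_d.+1, sphere R d x ->
     gen_hyperinterp xs w a n (hyperinterp xs w Y n f) x =
       hyperinterp xs w Y n (gen_hyperinterp xs w a n f) x /\
     hyperinterp xs w Y n (gen_hyperinterp xs w a n f) x =
       gen_hyperinterp xs w a n f x).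
Proof.
have d0 : (0 < d)%N by exact: ltnW.
split.
  rewrite /discrete_inner /gen_hyperinterp.
  under eq_bigr do rewrite mulr_sumr mulr_suml.
  rewrite exchange_big/=; apply: eq_bigr => j _.
  rewrite mulr_sumr; apply: eq_bigr => i _.
  by rewrite dotC; ring.
move=> x x1.
have genE h z : gen_hyperinterp xs w a n h z =
    discrete_inner xs w h (fun y => filter_kernel d a n (dot y z)).
  by apply: eq_bigr => j _; rewrite dotC.
have LG : hyperinterp xs w Y n (gen_hyperinterp xs w a n f) x =
    gen_hyperinterp xs w a n f x.
  rewrite /gen_hyperinterp hyperinterp_sum; apply: eq_bigr => j _.
  by rewrite hyperinterp_filter_kernel.
split=> //; rewrite LG !genE hyperinterp_self_adjoint.
by apply: eq_discrete_inner => // y y1; exact: hyperinterp_filter_kernel.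
Qed.
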